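(* Let $k$ be a positive integer with $\mathcal A_k\neq\varnothing$. Then the sequence of iterates $z(k),z^2(k),z^3(k),\dots$ takes only finitely many values (it eventually reaches a fixed point of $z$), and \[c(k)=k\cdot\operatorname{lcm}\{z^i(k)\}_{i=1}^{\infty}.\]
   Context: $F_n$ is the $n$-th Fibonacci number ($F_0=0,F_1=1$). For a positive integer $n$, $z(n)$ is the least positive integer $m$ with $n\mid F_m$, and $z^i$ denotes the $i$-th iterate of $z$. For a positive integer $k$, $\mathcal A_k:=\{n\in\mathbb N:\ z(n)\mid n \text{ and } n/z(n)=k\}$, and $c(k):=\min\mathcal A_k$. *)

(* Defs.v *)
From mathcomp Require Import all_boot.
From Stdlib Require Import ClassicalEpsilon.
Set Implicit Arguments. Unset Strict Implicit. Unset Printing Implicit Defensive.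

Fixpoint fib (n : nat) : nat :=
  match n with
  | 0 => 0
  | 1 => 1
  | (m.+1 as p).+1 => fib p + fib m
  end.

(* z(n) = least positive m with n | F_m (exists for every n >= 1).
   Defined classically; default value 0 if no such m exists (only n = 0). *)
Definition zpred (n : nat) : pred nat := fun m => (0 < m) && (n %| fib m).

Definition z (n : nat) : nat :=
  match excluded_middle_informative (exists m, zpred n m) with
  | left H => ex_minn H
  | right _ => 0
  end.

Definition inA (k n : nat) : bool :=
  [&& 0 < n, z n %| n & n %/ z n == k].

Definition c (k : nat) : nat :=
  match excluded_middle_informative (exists n, inA k n) with
  | left H => ex_minn H
  | right _ => 0
  end.

(* Main.v *)
(* An n in A_k satisfies n = k z(n); since d | n implies z(d) | z(n), every
   z^i(k) divides z(n), so L = lcm z^i(k) divides z(n) and kL <= n.  Conversely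
   k z(n) | F_(z(n)) with z(n) = Lt descends to kL | F_L, because
   v_p(F_(Lt)) <= v_p(F_L) + v_p(t) for every prime p dividing F_L (with 4 | F_L
   if p = 2); hence z(kL) = L and kL is in A_k.
   The iterates are bounded by z(n), so they become periodic.  A periodic point
   has no prime factor >= 7, since z lowers the valuation at the largest prime;
   it then has the form d 5^e with d | 12, and z(d 5^e) = z(d) 5^e, which reaches
   5^e or 12 5^e. *)
Require Import Defs.
From mathcomp Require Import all_boot all_algebra.
From mathcomp Require Import ring zify.

Import GRing.Theory.

Local Arguments fib : simpl never.

(** * Fibonacci identities and divisibility *)

Lemma fibSS n : fib n.+2 = fib n.+1 + fib n. Proof. by []. Qed.

Lemma fib_gt0 n : 0 < n -> 0 < fib n.
Proof.
case: n => // n _; elim: n => // n IHn.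
by rewrite fibSS addn_gt0 IHn.
Qed.

Lemma fib_addS m n : fib (m.+1 + n) = fib m.+1 * fib n.+1 + fib m * fib n.
Proof.
elim: m n => [|m IHm] n; first by rewrite mul1n addn0.
by rewrite addSnnS IHm !fibSS; lia.
Qed.

Lemma coprime_fibS n : coprime (fib n.+1) (fib n).
Proof.
elim: n => // n IHn.
by rewrite fibSS /coprime gcdnC gcdnDl -/(coprime _ _).
Qed.

(** Binomial expansion of phi^((n+1)t + j), where phi^2 = phi + 1 and hence phi^(n+1) = F_(n+1) phi
    + F_n. The induction on t is Pascal's rule. *)
Lemma fib_mulD n t j :
  fib (n.+1 * t + j) =
  \sum_(i < t.+1) 'C(t, i) * fib n.+1 ^ i * fib n ^ (t - i) * fib (i + j).
Proof.
elim: t j => [|t IHt] j.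
  by rewrite big_ord1 muln0 bin0 !mul1n.
rewrite mulnS -addnA (addnCA n.+1) IHt.
under eq_bigr => i _ do rewrite (addnCA i) fib_addS mulnDr.
rewrite big_split [LHS]addnC [RHS]big_ord_recl /= bin0 subn0.
under [in RHS]eq_bigr => i _ do
  rewrite /bump /= add1n binS subSS 2!mulnDl mulnDl.
rewrite big_split /= addnA; congr (_ + _).
- rewrite big_ord_recl [in RHS]big_ord_recr /= bin0 subn0 bin_small // !mul0n addn0.
  congr (_ + _); first by rewrite add0n !mul1n mulnA -expnSr.
  apply: eq_bigr => i _; rewrite /bump /= add1n.
  by rewrite -[in RHS](subnSK (ltn_ord i)) !expnS; ring.
- by apply: eq_bigr => i _; rewrite addSn expnS; ring.
Qed.

Lemma dvdn_fib m n : m %| n -> fib m %| fib n.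
Proof.
case/dvdnP=> t ->; elim: t => [|t IHt]; first by rewrite dvdn0.
case: m IHt => [|m] IHt; first by rewrite muln0.
rewrite mulSn fib_addS; apply: dvdn_add; [exact: dvdn_mulr | exact: dvdn_mull].
Qed.

Lemma dvdn_fib_addl d m r :
  0 < m -> d %| fib m -> (d %| fib (m + r)) = (d %| fib r).
Proof.
case: m => // m _ dm; rewrite fib_addS (dvdn_addr _ (dvdn_mulr _ dm)) Gauss_dvdr //.
exact: coprime_dvdl dm (coprime_fibS m).
Qed.

(** * Primes dividing Fibonacci numbers *)

Lemma fib_cassini n :
  ((fib n.+2)%:Z * (fib n)%:Z - (fib n.+1)%:Z ^+ 2 = (-1) ^+ n.+1 :> int)%R.
Proof.
elim: n => // n IHn.
rewrite [RHS]exprS -IHn (fibSS n.+1) (fibSS n) !PoszD; ring.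
Qed.

(** As F_1 = F_2 = 1, [fib_mulD] reads F_(2p+j) = sum of C(p,i) F_(i+j), and modulo p only the terms
    i = 0 and i = p survive. *)
Lemma fib_double_prime p j :
  prime p -> fib (p.*2 + j) = fib (p + j) + fib j %[mod p].
Proof.
case: p => // p p_pr.
rewrite -mul2n (fib_mulD 1) big_ord_recr big_ord_recl /=.
rewrite bin0 binn !exp1n !mul1n add0n addnAC -modnDmr [X in (_ + X) %% _](_ : _ = 0).
  by rewrite addn0 addnC.
apply/eqP/dvdn_sum => i _; rewrite -!mulnA dvdn_mulr // prime_dvd_bin //.
by rewrite /bump /= ltnS.
Qed.

(* With u, v the residues of F_(p+1), F_p, the congruence F_(2p+j) = F_(p+j) + F_j
   for j = 0, 1 reads v(2u - v) = v and u^2 + v^2 = u + 1. *)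
Lemma prime_dvd_fib p :
  prime p -> p != 5 -> (p %| fib p.-1) || (p %| fib p.+1).
Proof.
case: p => // p p_pr p5; have [->|p2] := eqVneq p.+1 2; first by [].
have p_odd : odd p.+1 by case: (even_prime p_pr) p2 => [->|].
pose f i : 'F_p.+1 := ((fib i)%:R)%R.
have natF0 n : (n%:R == 0 :> 'F_p.+1)%R = (p.+1 %| n).
  by rewrite (dvdn_pcharf (pchar_Fp p_pr)).
have fD j : (f (p.+1.*2 + j)%N = f (p.+1 + j)%N + f j)%R.
  rewrite /f -natrD; apply/val_inj => /=; rewrite !(val_Fp_nat p_pr).
  exact: fib_double_prime.
have n5 : (5%:R != 0 :> 'F_p.+1)%R.
  by rewrite natF0 dvdn_prime2.
have fw : (f p = f p.+2 - f p.+1)%R by rewrite /f fibSS natrD; ring.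
have f0 : f 0 = 0%R by [].
have f1 : f 1 = 1%R by [].
have E0 : (f p.+1 * (f p.+2 + f p) = f p.+1)%R.
  have := fD 0; rewrite !addn0 f0 addr0 => E; rewrite -[RHS]E.
  by rewrite /f -addnn fib_addS natrD !natrM; ring.
have E1 : (f p.+2 ^+ 2 + f p.+1 ^+ 2 = f p.+2 + 1)%R.
  have := fD 1; rewrite f1 !addn1 => <-.
  by rewrite /f -addnn -addSn fib_addS natrD !natrM.
have cas : (f p.+2 * f p - f p.+1 ^+ 2 = -1)%R.
  have := congr1 (fun x : int => x%:~R : 'F_p.+1)%R (fib_cassini p).
  by rewrite rmorphB rmorphM rmorphXn /= -signr_odd p_odd !rmorphN1.
rewrite -!natF0 -!/(f _).
(* If v = 0, Cassini gives u^2 = -1 and the second congruence gives u = -2, so 5 = 0, which is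
   excluded. *)
have [v0|v0] := eqVneq (f p.+1) 0%R.
  have sq_u : (f p.+2 ^+ 2 = -1)%R by rewrite -cas fw v0; ring.
  have u2 : (f p.+2 = -2)%R.
    transitivity (f p.+2 ^+ 2 + f p.+1 ^+ 2 - 1)%R; first by rewrite E1; ring.
    by rewrite sq_u v0; ring.
  case/eqP: n5; transitivity (f p.+2 ^+ 2 + 1)%R; first by rewrite u2; ring.
  by rewrite sq_u; ring.
(* If v is invertible, v = 2u - 1 turns the second congruence into 5u(u - 1) = 0. Then u = 0, or u =
   v = 1 and the preceding term u - v vanishes. *)
have v1 : (f p.+1 = 2 * f p.+2 - 1)%R.
  have {}E0 : (f p.+2 + f p = 1)%R by apply: (mulfI v0); rewrite E0 mulr1.
  by transitivity (2 * f p.+2 - (f p.+2 + f p))%R; [rewrite fw; ring | rewrite E0].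
have : (5 * (f p.+2 * (f p.+2 - 1)) == 0)%R.
  apply/eqP; transitivity (f p.+2 ^+ 2 + f p.+1 ^+ 2 - (f p.+2 + 1))%R.
    by rewrite v1; ring.
  by rewrite E1 subrr.
rewrite !mulf_eq0 (negPf n5) /= => /orP[->|]; first by rewrite orbT.
by rewrite subr_eq0 fw v1 => /eqP ->; apply/orP; left; apply/eqP; ring.
Qed.

(** * Valuations of F_(mt) *)

Lemma fib_mul_expand n t : exists r,
  fib (n.+1 * t.+2) =
  fib n.+1 * (t.+2 * fib n ^ t.+1 +
              ('C(t.+2, 2) * fib n.+1 * fib n ^ t + fib n.+1 ^ 2 * r)).
Proof.
(* The terms of [fib_mulD] of index at least 3, with F_(n+1)^3 taken out. *)
exists (\sum_(i < t)
  'C(t.+2, i.+3) * fib n.+1 ^ i * fib n ^ (t - i.+1) * fib i.+3).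
rewrite -[_ * t.+2]addn0 fib_mulD 3!big_ord_recl /= /bump /= !addn0 !add1n.
rewrite -[fib 0]/0 -[fib 1]/1 -[fib 2]/1 bin1 !muln1 muln0 add0n.
rewrite expn1 !subSS !subn0 mulnDr (mulnDr (fib _) ('C(_, _) * _ * _)) !big_distrr.
congr (_ + (_ + _)); [by ring | by ring |].
by apply: eq_bigr => i _; rewrite /= !add1n !subSS addn0 !expnS; ring.
Qed.

(** By [fib_mul_expand], F_(mq)/F_m is q F_(m-1)^(q-1) plus multiples of F_m. For p != q it is prime
    to p. For p = q the other terms are divisible by p^2, through p | C(p,2) if p is odd and through
    4 | F_m if p = 2, so its valuation is 1. *)
Lemma logn_fib_mul_prime p q m :
    prime p -> prime q -> 0 < m -> p %| fib m -> (p = 2 -> 4 %| fib m) ->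
  logn p (fib (m * q)) <= logn p (fib m) + logn p q.
Proof.
case: m => // n p_pr + _ pF F4; case: q => [|[|t]] // q_pr.
have pG e : coprime p (fib n ^ e).
  by rewrite coprimeXr // (coprime_dvdl pF) ?coprime_fibS.
have [r E] := fib_mul_expand n t.
have Fgt0 : 0 < fib (n.+1 * t.+2) by rewrite fib_gt0.
move: Fgt0; rewrite E muln_gt0 => /andP[Fgt0 Xgt0].
rewrite lognM // leq_add2l; have [eq_pq|neq_pq] := eqVneq p t.+2; last first.
  rewrite logn_coprime // prime_coprime // dvdn_addl; last first.
    rewrite dvdn_add // ?expnS -?mulnA; last exact: dvdn_mulr.
    by rewrite dvdn_mull // dvdn_mulr.
  by rewrite -prime_coprime // coprimeMr pG prime_coprime // dvdn_prime2 // neq_pq.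
have [s ->] : exists s,
    'C(t.+2, 2) * fib n.+1 * fib n ^ t + fib n.+1 ^ 2 * r = t.+2 * (t.+2 * s).
  suff /dvdnP[s ->] : t.+2 * t.+2 %|
      'C(t.+2, 2) * fib n.+1 * fib n ^ t + fib n.+1 ^ 2 * r.
    by exists s; ring.
  rewrite -eq_pq; apply: dvdn_add; apply: dvdn_mulr; last exact: dvdn_mul.
  have [p2|p2] := eqVneq p 2; first by rewrite dvdn_mull // p2 F4.
  by rewrite dvdn_mul // prime_dvd_bin //= ltn_neqAle eq_sym p2 prime_gt1.
rewrite -eq_pq -mulnDr mulnC logn_Gauss //.
by rewrite /coprime addnC (mulnC p) gcdnMDl -/(coprime _ _).
Qed.

Lemma logn_fib_mul p m t :
    prime p -> 0 < m -> 0 < t -> p %| fib m -> (p = 2 -> 4 %| fib m) ->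
  logn p (fib (m * t)) <= logn p (fib m) + logn p t.
Proof.
move=> p_pr; elim/ltn_ind: t m => t IHt m m_gt0 t_gt0 pF F4.
have [t_le1|t_gt1] := leqP t 1.
  by rewrite (_ : t = 1) ?muln1 ?leq_addr //; lia.
have q_pr := pdiv_prime t_gt1; have := pdiv_dvd t.
move: (pdiv t) q_pr => q q_pr /dvdnP[s def_t].
have s_gt0 : 0 < s by case: s def_t t_gt0 => // ->.
have dvd_mq : fib m %| fib (m * q) by rewrite dvdn_fib ?dvdn_mulr.
rewrite def_t (mulnC s) mulnA (lognM p (prime_gt0 q_pr) s_gt0) addnA.
apply: leq_trans (IHt s _ (m * q) _ s_gt0 _ _) _.
- by rewrite def_t ltn_Pmulr ?prime_gt1.
- by rewrite muln_gt0 m_gt0 prime_gt0.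
- exact: dvdn_trans dvd_mq.
- by move=> p2; apply: dvdn_trans (F4 p2) dvd_mq.
by rewrite leq_add2r logn_fib_mul_prime.
Qed.

Lemma dvdn_fib_lift p m : p %| fib m -> p * fib m %| fib (m * p).
Proof.
case: p => [|[|t]] pF.
- by rewrite muln0 dvdn0.
- by rewrite mul1n muln1.
case: m pF => [|n] pF; first by rewrite dvdn0.
have [r ->] := fib_mul_expand n t.
rewrite mulnC dvdn_pmul2l ?fib_gt0 //.
apply: dvdn_add; first exact: dvdn_mulr.
apply: dvdn_add; first by rewrite mulnAC dvdn_mull.
by rewrite expnS -mulnA dvdn_mulr.
Qed.

(** Each multiplication of the index by p gains one power of p. For e <= s+1 the truncated
    subtraction leaves the index at m. *)
Lemma dvdn_fib_expn p s e m :
  p ^ s.+1 %| fib m -> p ^ e %| fib (m * p ^ (e - s.+1)).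
Proof.
move=> psF; have [le_es|/ltnW/subnKC] := leqP e s.+1.
  by apply: dvdn_trans (dvdn_exp2l p le_es) _; rewrite (eqP le_es) muln1.
move: (e - s.+1) => i <-; elim: i => [|i IHi]; first by rewrite muln1 addn0.
have pF : p %| fib (m * p ^ i) by rewrite (dvdn_trans _ IHi) // expnS dvdn_mulr.
rewrite addnS expnS [X in _ %| fib (_ * X)]expnSr mulnA.
exact: dvdn_trans (dvdn_mul (dvdnn p) IHi) (dvdn_fib_lift p _ pF).
Qed.

(** * Indices w with x | F_w and only small prime factors *)

(** For p != 5 take w = p - 1 or p + 1. A prime factor q >= P of p + 1 <= P + 1 is P + 1, which is
    even, or P, and then p + 1 = P contradicts parity. *)
Lemma exists_rank_prime p P : prime p -> prime P -> 6 < P -> p <= P ->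
  exists w, [/\ 0 < w, p %| fib w & forall q, prime q -> q %| w -> q < P].
Proof.
move=> p_pr P_pr P_gt6 le_pP; have p_gt1 := prime_gt1 p_pr.
have [->|p5] := eqVneq p 5.
  by exists 5; split=> // q _ /(@dvdn_leq _ 5 isT); lia.
have P_odd : odd P by case: (even_prime P_pr) P_gt6 => [->|].
have /orP[pF|pF] := prime_dvd_fib p p_pr p5.
  have p1_gt0 : 0 < p.-1 by lia.
  by exists p.-1; split=> // q _ /(dvdn_leq p1_gt0); lia.
exists p.+1; split=> // q q_pr q_dvd.
have le_q : q <= p.+1 by exact: dvdn_leq.
have neq_qP1 : q != P.+1.
  by apply/eqP => eq_q; case: (even_prime q_pr) => [|]; rewrite eq_q /= ?P_odd //; lia.
suff : q != P by lia.
apply/eqP => eq_qP; move: q_dvd; rewrite eq_qP => /dvdnP[k def_p].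
have k1 : k = 1 by nia.
case: (even_prime p_pr) => [|p_odd]; first by lia.
by move: P_odd; rewrite -[P]mul1n -k1 -def_p /= p_odd.
Qed.

Lemma exists_rank_smooth x P : 0 < x -> prime P -> 6 < P ->
    (forall p, prime p -> p %| x -> p < P) ->
  exists w, [/\ 0 < w, x %| fib w & forall q, prime q -> q %| w -> q < P].
Proof.
move=> + P_pr P_gt6; elim/ltn_ind: x => x IHx x_gt0 smooth_x.
have [x_le1|x_gt1] := leqP x 1.
  have -> : x = 1 by lia.
  by exists 1; split=> // q /prime_gt1 q_gt1 /(@dvdn_leq _ 1 isT); lia.
have p_pr := pdiv_prime x_gt1; have := pdiv_dvd x.
move: (pdiv x) p_pr => p p_pr /dvdnP[y def_x].
have y_gt0 : 0 < y by case: y def_x x_gt0 => // ->.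
have [||q q_pr qy|w [w_gt0 yF smooth_w]] := IHx y.
- by rewrite def_x ltn_Pmulr ?prime_gt1.
- by [].
- by apply: smooth_x => //; rewrite def_x dvdn_mulr.
have lt_pP : p < P by apply: smooth_x => //; rewrite def_x dvdn_mull.
have [v [v_gt0 pF smooth_v]] := exists_rank_prime p P p_pr P_pr P_gt6 (ltnW lt_pP).
(* Both y and p divide F_(wv), and the extra factor p in the index makes py divide F_(wvp). *)
exists (w * v * p); split.
- by rewrite !muln_gt0 w_gt0 v_gt0 prime_gt0.
- rewrite def_x mulnC; apply: dvdn_trans (dvdn_fib_lift p _ _).
    by rewrite dvdn_mul // (dvdn_trans yF) // dvdn_fib // dvdn_mulr.
  by rewrite (dvdn_trans pF) // dvdn_fib // dvdn_mull.
move=> q q_pr; rewrite !Euclid_dvdM // => /orP[/orP[]|].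
- exact: smooth_w.
- exact: smooth_v.
by rewrite dvdn_prime2 // => /eqP->.
Qed.

(** * Basic properties of z *)

(** The default value of [z] is never taken at a positive n: any prime above 6 and n bounds the
    prime factors of n, so [exists_rank_smooth] supplies an index. *)
Lemma zpred_z n : 0 < n -> zpred n (z n).
Proof.
move=> n_gt0.
have H : exists m, zpred n m.
  have [P P_gt P_pr] := prime_above (maxn 6 n).
  have [||||w [w_gt0 nF _]] := exists_rank_smooth n P; rewrite ?(leq_trans _ P_gt) ?ltnS ?leq_maxl //.
    move=> p _ /(dvdn_leq n_gt0) le_pn.
    by rewrite (leq_ltn_trans le_pn) // (leq_trans _ P_gt) // ltnS leq_maxr.
  by exists w; rewrite /zpred w_gt0.
rewrite /z; case: ClassicalEpsilon.excluded_middle_informative => // H'.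
by case: ex_minnP.
Qed.

Lemma z_min n m : zpred n m -> z n <= m.
Proof.
move=> nm; rewrite /z; case: ClassicalEpsilon.excluded_middle_informative => // H.
by case: ex_minnP => w _; apply.
Qed.

Lemma z_gt0 n : 0 < n -> 0 < z n.
Proof. by case/zpred_z/andP. Qed.

Lemma dvdn_fibE n m : 0 < n -> (n %| fib m) = (z n %| m).
Proof.
move=> n_gt0; have /andP[z_gt0 nFz] := zpred_z n n_gt0.
apply/idP/idP => [nF|/dvdn_fib]; last exact: dvdn_trans.
have nFr : n %| fib (m %% z n).
  move: nF; rewrite {1}(divn_eq m (z n)); have [->//|q_gt0] := posnP (m %/ z n).
  rewrite dvdn_fib_addl ?muln_gt0 ?q_gt0 //.
  by apply: dvdn_trans nFz _; rewrite dvdn_fib ?dvdn_mull.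
rewrite /dvdn -leqn0 leqNgt; apply/negP => r_gt0.
have /z_min : zpred n (m %% z n) by rewrite /zpred r_gt0.
by rewrite leqNgt ltn_mod z_gt0.
Qed.

Lemma z_dvd d n : 0 < n -> d %| n -> z d %| z n.
Proof.
move=> n_gt0 dn; rewrite -dvdn_fibE ?(dvdn_gt0 n_gt0) //.
by apply: dvdn_trans dn _; rewrite dvdn_fibE.
Qed.

Lemma z_lcm a b : 0 < a -> 0 < b -> z (lcmn a b) = lcmn (z a) (z b).
Proof.
move=> a_gt0 b_gt0; have ab_gt0 : 0 < lcmn a b by rewrite lcmn_gt0 a_gt0.
apply/eqP; rewrite eqn_dvd; apply/andP; split; last first.
  by rewrite dvdn_lcm !z_dvd ?dvdn_lcml ?dvdn_lcmr.
by rewrite -dvdn_fibE // dvdn_lcm !dvdn_fibE // dvdn_lcml dvdn_lcmr.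
Qed.

(** [z] is defined through excluded middle and does not compute; this certifies its small values by
    evaluating a boolean check. *)
Lemma z_eq n m :
  zpred n m -> all (fun i => ~~ zpred n i) (iota 1 m.-1) -> z n = m.
Proof.
move=> nm /allP min_m; have n_gt0 : 0 < n.
  by case: n nm {min_m} => // /andP[m_gt0]; rewrite dvd0n eqn0Ngt fib_gt0.
apply/eqP; rewrite eqn_leq z_min //= leqNgt; apply/negP => lt_zm.
have /andP[z_gt0 nFz] := zpred_z n n_gt0.
have /min_m : z n \in iota 1 m.-1 by rewrite mem_iota z_gt0; lia.
by rewrite /zpred z_gt0 nFz.
Qed.

Lemma z_expn5 e : z (5 ^ e) = 5 ^ e.
Proof.
have e5_gt0 : 0 < 5 ^ e by rewrite expn_gt0.
case: e e5_gt0 => [|e] e5_gt0; first exact: z_eq.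
apply/eqP; rewrite eqn_dvd -dvdn_fibE //; apply/andP; split.
  by have := @dvdn_fib_expn 5 0 e.+1 5 isT; rewrite expnS subn1.
have z5 : z 5 = 5 by exact: z_eq.
have m_gt0 := z_gt0 _ e5_gt0.
have m5 : 5 %| z (5 ^ e.+1) by rewrite -{1}z5 z_dvd // expnS dvdn_mulr.
have: 5 ^ e.+1 %| fib (z (5 ^ e.+1)) by rewrite dvdn_fibE.
(* With m = 5t, v_5(F_(5t)) <= 1 + v_5(t) = v_5(m), so 5^(e+1) | F_m forces 5^(e+1) | m. *)
move: (z _) m_gt0 m5 => m m_gt0 /dvdnP[t def_m].
have t_gt0 : 0 < t by case: t def_m m_gt0 => // ->.
rewrite !pfactor_dvdn ?fib_gt0 // => /leq_trans -> //.
by rewrite def_m lognM // addnC mulnC -[logn 5 5]/(logn 5 (fib 5)) logn_fib_mul.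
Qed.

(** * Periodic points of z *)

Lemma iter_z_gt0 i x : 0 < x -> 0 < iter i z x.
Proof. by move=> x_gt0; elim: i => //= i; apply: z_gt0. Qed.

(** After one period, [mu x] is at most the maximum of [b] and [mu x - r]; as r > 0, it cannot
    exceed [b]. *)
Lemma periodic_bound (Q : nat -> Prop) (mu : nat -> nat) b r x :
    (forall y, Q y -> Q (z y) /\ mu (z y) <= maxn b (mu y).-1) ->
    0 < r -> iter r z x = x -> Q x ->
  mu x <= b.
Proof.
move=> Qz r_gt0 per_x Qx.
have bound i : Q (iter i z x) /\ mu (iter i z x) <= maxn b (mu x - i).
  elim: i => [|i [Qi mui]]; first by rewrite subn0 leq_maxr.
  by have [] := Qz _ Qi => /= ? ?; split=> //; lia.
by have [_] := bound r; rewrite per_x; lia.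
Qed.

Definition smooth P y := 0 < y /\ forall q, prime q -> q %| y -> q <= P.

Lemma smooth_dvd P y w : smooth P w -> y %| w -> smooth P y.
Proof.
move=> [w_gt0 smooth_w] yw; split=> [|q q_pr qy]; first exact: dvdn_gt0 yw.
by apply: smooth_w => //; apply: dvdn_trans yw.
Qed.

(* For P >= 7, no prime p <= P other than P itself lets P divide z(p^e), and
   z(P^e) divides P^(e-1)(P^2-1). *)
Lemma logn_z_smooth P y : prime P -> 6 < P -> smooth P y ->
  smooth P (z y) /\ logn P (z y) <= (logn P y).-1.
Proof.
move=> P_pr P_gt6 [y_gt0 smooth_y].
have [u copPu def_y] := pfactor_coprime P_pr y_gt0.
move: (logn P y) def_y => e def_y.
have u_gt0 : 0 < u by case: u def_y y_gt0 {copPu} => // ->.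
have [q q_pr qu|w [w_gt0 uF smooth_w]] := exists_rank_smooth u P u_gt0 P_pr P_gt6.
  rewrite ltn_neqAle smooth_y ?def_y ?dvdn_mulr // andbT.
  apply: contraTneq copPu => <-; first by rewrite prime_coprime // qu.
have [v [v_gt0 PF smooth_v]] := exists_rank_prime P P P_pr P_pr P_gt6 (leqnn P).
have PN n : 0 < n -> (forall q, prime q -> q %| n -> q < P) -> coprime P n.
  move=> _ smooth_n; rewrite prime_coprime //.
  by apply/negP => /(smooth_n _ P_pr); rewrite ltnn.
(* For y = u P^e, u | F_w and P | F_v give P^e | F_(wv P^(e-1)). As w and v are prime to P, this
   index has P-valuation e - 1. *)
have W_gt0 : 0 < w * v * P ^ (e - 1) by rewrite !muln_gt0 w_gt0 v_gt0 expn_gt0 prime_gt0.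
have zW : z y %| w * v * P ^ (e - 1).
  rewrite -dvdn_fibE // def_y Gauss_dvd 1?coprime_sym ?coprimeXl //.
  rewrite (dvdn_trans uF) ?dvdn_fib -?mulnA ?dvdn_mulr //= mulnA.
  apply: (@dvdn_fib_expn P 0); rewrite expn1 (dvdn_trans PF) // dvdn_fib //.
  by rewrite dvdn_mull.
split; last first.
  apply: leq_trans (dvdn_leq_log P W_gt0 zW) _.
  by rewrite -mulnA !logn_Gauss ?PN // pfactorK // subn1.
apply: smooth_dvd zW; split=> // q q_pr; rewrite !Euclid_dvdM // => /orP[/orP[|]|].
- by move/smooth_w => /(_ q_pr)/ltnW.
- by move/smooth_v => /(_ q_pr)/ltnW.
by rewrite Euclid_dvdX // => /andP[+ _]; rewrite dvdn_prime2 // => /eqP->.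
Qed.

Lemma periodic_smooth5 r x : 0 < x -> 0 < r -> iter r z x = x -> smooth 5 x.
Proof.
move=> x_gt0 r_gt0 per_x; split=> // p p_pr px; rewrite leqNgt; apply/negP => p_gt5.
have p_neq6 : p != 6 by apply: contraTneq p_pr => ->.
have x_gt1 : 1 < x by apply: leq_trans (dvdn_leq x_gt0 px); apply: prime_gt1.
have P_pr := max_pdiv_prime x_gt1; have Px := max_pdiv_dvd x.
have P_max q : prime q -> q %| x -> q <= max_pdiv x.
  by move=> q_pr qx; rewrite max_pdiv_max // mem_primes q_pr x_gt0.
move: (max_pdiv x) P_pr Px P_max => P P_pr Px P_max.
have P_gt6 : 6 < P by have := P_max _ p_pr px; lia.
(* At the largest prime factor P >= 7 the valuation decreases to 0 along the orbit, although P
   divides x. *)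
have := @periodic_bound (smooth P) (logn P) 0 r x _ r_gt0 per_x.
rewrite leqn0 => /(_ _ (conj x_gt0 P_max))/eqP => logP.
have : 0 < logn P x by rewrite logn_gt0 mem_primes P_pr x_gt0.
by rewrite logP // => y smooth_y; rewrite max0n; apply: logn_z_smooth.
Qed.

Lemma dvdn_smooth5 y w : smooth 5 y ->
    2 ^ logn 2 y %| w -> 3 ^ logn 3 y %| w -> 5 ^ logn 5 y %| w ->
  y %| w.
Proof.
move=> [y_gt0 smooth_y] w2 w3 w5; apply/dvdn_partP => // p.
rewrite mem_primes y_gt0 => /and3P[p_pr _ py]; rewrite p_part.
have := smooth_y p p_pr py.
by case: p p_pr {py} => [|[|[|[|[|[|p]]]]]].
Qed.

Lemma logn_z_smooth5 y : smooth 5 y ->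
  [/\ smooth 5 (z y), logn 2 (z y) <= maxn 2 (logn 2 y).-1
    & logn 3 (z y) <= maxn 1 (logn 3 y).-1].
Proof.
move=> smooth_y; have [y_gt0 _] := smooth_y.
(* The exponents 4 and 2 come from F_12 = 144 = 2^4 * 3^2, and 5^c divides F_(5^c). The factor 12
   gives the bounds 2 and 1. *)
set w := 12 * 2 ^ (logn 2 y - 4) * 3 ^ (logn 3 y - 2) * 5 ^ logn 5 y.
have e_gt0 p e : 0 < p.+1 ^ e by rewrite expn_gt0.
have w_gt0 : 0 < w by rewrite !muln_gt0 !e_gt0.
have fib_dvd m n : m %| n -> fib m %| fib n by apply: dvdn_fib.
have zw : z y %| w.
  rewrite -dvdn_fibE //; apply: dvdn_smooth5 => //.
  - apply: dvdn_trans (@dvdn_fib_expn 2 3 _ 12 isT) (fib_dvd _ _ _).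
    by rewrite /w -!mulnA dvdn_mul // dvdn_mulr.
  - apply: dvdn_trans (@dvdn_fib_expn 3 1 _ 12 isT) (fib_dvd _ _ _).
    by rewrite /w -!mulnA dvdn_mul // mulnCA dvdn_mulr.
  by rewrite dvdn_fibE // z_expn5 dvdn_mull.
have logw p : logn p w = logn p 12 + (logn 2 y - 4) * logn p 2 +
    (logn 3 y - 2) * logn p 3 + logn 5 y * logn p 5.
  by rewrite /w !lognM ?muln_gt0 ?e_gt0 // !lognX.
split.
- apply: smooth_dvd zw; split=> // q q_pr.
  rewrite !Euclid_dvdM // !Euclid_dvdX // -[12]/(2 * 2 * 3) !Euclid_dvdM //.
  by rewrite !dvdn_prime2 // => /orP[/orP[/orP[]|]|]; lia.
- apply: leq_trans (dvdn_leq_log 2 w_gt0 zw) _.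
  by rewrite logw -[logn 2 12]/2 -[logn 2 2]/1 -[logn 2 3]/0 -[logn 2 5]/0; lia.
apply: leq_trans (dvdn_leq_log 3 w_gt0 zw) _.
by rewrite logw -[logn 3 12]/1 -[logn 3 2]/0 -[logn 3 3]/1 -[logn 3 5]/0; lia.
Qed.

Lemma periodic_shape r x : 0 < x -> 0 < r -> iter r z x = x ->
  exists d e, d %| 12 /\ x = d * 5 ^ e.
Proof.
move=> x_gt0 r_gt0 per_x; have smooth_x := periodic_smooth5 r x x_gt0 r_gt0 per_x.
have x2 : logn 2 x <= 2.
  apply: (@periodic_bound (smooth 5) _ _ r) => // y.
  by case/logn_z_smooth5.
have x3 : logn 3 x <= 1.
  apply: (@periodic_bound (smooth 5) _ _ r) => // y.
  by case/logn_z_smooth5.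
have [d cop5d def_x] := @pfactor_coprime 5 x isT x_gt0.
exists d, (logn 5 x); split=> //.
rewrite -(@Gauss_dvdl _ _ (5 ^ logn 5 x)) ?coprimeXr 1?coprime_sym //.
apply: (@dvdn_trans x); first by rewrite def_x dvdn_mulr.
apply: dvdn_smooth5 => //.
- by apply: dvdn_trans (dvdn_exp2l 2 x2) _; rewrite dvdn_mulr.
- by apply: dvdn_trans (dvdn_exp2l 3 x3) _; rewrite dvdn_mulr.
by rewrite dvdn_mull.
Qed.

(** Both d and z(d), a divisor of z(12) = 12, are prime to 5, so the products are lcms and [z_lcm]
    applies. *)
Lemma z_mul_expn5 d e : d %| 12 -> z (d * 5 ^ e) = z d * 5 ^ e.
Proof.
move=> d12; have z12 : z 12 = 12 by apply: z_eq.
have e_gt0 : 0 < 5 ^ e by rewrite expn_gt0.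
have lcm5 m : m %| 12 -> lcmn m (5 ^ e) = m * 5 ^ e.
  move=> m12; have : coprime m (5 ^ e) by rewrite coprimeXr // (coprime_dvdl m12).
  by move=> /eqP cop; rewrite -muln_lcm_gcd cop muln1.
rewrite -lcm5 // z_lcm ?(dvdn_gt0 _ d12) // z_expn5 lcm5 //.
by rewrite -z12 z_dvd.
Qed.

(** The map is 1 -> 1 and 2 -> 3 -> 4 -> 6 -> 12 -> 12; the longest way to a fixed point, from 2,
    has four steps. *)
Lemma z_iter4_dvd12 d : d %| 12 -> z (iter 4 z d) = iter 4 z d /\ iter 4 z d %| 12.
Proof.
have z1 : z 1 = 1 by apply: z_eq.
have z2 : z 2 = 3 by apply: z_eq.
have z3 : z 3 = 4 by apply: z_eq.
have z4 : z 4 = 6 by apply: z_eq.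
have z6 : z 6 = 12 by apply: z_eq.
have z12 : z 12 = 12 by apply: z_eq.
move=> d12; have : d \in divisors 12 by rewrite -dvdn_divisors.
by rewrite -[divisors 12]/[:: 1; 2; 3; 4; 6; 12] !inE
   => /or4P[||| /or3P[]] /eqP-> /=; rewrite ?(z1, z2, z3, z4, z6, z12).
Qed.

Lemma periodic_fixed r x : 0 < x -> 0 < r -> iter r z x = x ->
  exists i, z (iter i z x) = iter i z x.
Proof.
move=> x_gt0 r_gt0 /(periodic_shape _ _ x_gt0 r_gt0)[d [e [d12 ->]]].
have z12 : z 12 = 12 by apply: z_eq.
have iter_z i : iter i z (d * 5 ^ e) = iter i z d * 5 ^ e /\ iter i z d %| 12.
  elim: i => //= i [-> IH12].
  by rewrite z_mul_expn5 //; split=> //; rewrite -z12 z_dvd.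
exists 4; have [-> _] := iter_z 4; have [] := z_iter4_dvd12 d d12.
by move: (iter 4 z d) => f fix_f f12; rewrite z_mul_expn5 // fix_f.
Qed.

(** * Descent to F_L and the formula for c(k) *)

Lemma bounded_repeats (f : nat -> nat) b :
  (forall i, f i <= b) -> exists i j, i < j /\ f i = f j.
Proof.
move=> f_le; pose g (i : 'I_b.+2) : 'I_b.+1 := inord (f i).
have /injectivePn[i [j neq_ij /(congr1 val) /=]] : ~~ injectiveb g.
  by apply/negP => /injectiveP/leq_card; rewrite !card_ord ltnn.
rewrite !inordK ?ltnS // => eq_f.
by have [lt|lt|/ord_inj eq_ij] := ltngtP i j;
  [exists i, j | exists j, i | rewrite eq_ij eqxx in neq_ij].
Qed.

Lemma dvdn_fib_descent k L t : 0 < k -> 0 < L -> 0 < t ->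
    z k %| L -> (forall p, prime p -> p %| L -> z p %| L) ->
  k * (L * t) %| fib (L * t) -> k * L %| fib L.
Proof.
move=> k_gt0 L_gt0 t_gt0 zkL zL kLt.
have kL_gt0 : 0 < k * L by rewrite muln_gt0 k_gt0.
have F_gt0 : 0 < fib L by rewrite fib_gt0.
have pF p : prime p -> p %| k * L -> p %| fib L.
  move=> p_pr; rewrite Euclid_dvdM // dvdn_fibE ?prime_gt0 // => /orP[pk|/zL->//].
  by apply: dvdn_trans zkL; apply: z_dvd.
(* If L is even, z(2) = 3 divides L, so 6 | L and F_6 = 8 divides F_L. If L is odd, 4 | k and z(4) |
   z(k) | L. *)
have F4 : 4 %| k * L -> 4 %| fib L.
  have [L2 _|L2] := boolP (2 %| L).
    have z2 : z 2 = 3 by apply: z_eq.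
    have L6 : 6 %| L by rewrite (@Gauss_dvd 2 3) // L2 -z2 zL.
    exact: dvdn_trans (dvdn_fib 6 L L6).
  have cop4L : coprime (2 ^ 2) L by rewrite coprimeXl // prime_coprime.
  rewrite (Gauss_dvdl _ cop4L).
  by move=> k4; rewrite dvdn_fibE // (dvdn_trans _ zkL) // z_dvd.
apply/dvdn_partP => // p; rewrite mem_primes kL_gt0 => /and3P[p_pr _ p_kL].
rewrite p_part pfactor_dvdn //.
(* If p = 2 and 4 does not divide F_L, then 4 does not divide kL either, so v_2(kL) <= 1 <=
   v_2(F_L). Otherwise v_p(t) cancels from v_p(kLt) <= v_p(F_(Lt)) <= v_p(F_L) + v_p(t). *)
have [/andP[/eqP p2 nF4]|] := boolP ((p == 2) && ~~ (4 %| fib L)).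
  apply: (@leq_trans 1); last by rewrite logn_gt0 mem_primes p_pr F_gt0 pF.
  by rewrite -ltnS ltnNge -pfactor_dvdn // p2; apply: contra nF4.
rewrite negb_and negbK => F4p.
have {}F4p : p = 2 -> 4 %| fib L by move=> p2; rewrite p2 in F4p.
have Lt_gt0 : 0 < L * t by rewrite muln_gt0 L_gt0.
rewrite -(leq_add2r (logn p t)) -lognM //.
apply: leq_trans (logn_fib_mul p L t p_pr L_gt0 t_gt0 (pF p p_pr p_kL) F4p).
by rewrite -mulnA dvdn_leq_log // fib_gt0.
Qed.

Lemma prime_dvd_biglcm (I : finType) (F : I -> nat) p :
  prime p -> p %| \big[lcmn/1]_i F i -> exists i, p %| F i.
Proof.
move=> p_pr; elim/big_ind: _ => [|x y IHx IHy p_lcm|i _]; last by exists i.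
  by rewrite dvdn1 => /eqP p1; rewrite p1 in p_pr.
have : p %| x * y by rewrite (dvdn_trans p_lcm) // dvdn_lcm dvdn_mulr ?dvdn_mull.
by rewrite Euclid_dvdM // => /orP[/IHx|/IHy].
Qed.

Theorem theorem2p2 (k : nat) (hk : 0 < k) (hA : exists n, inA k n) :
  (* the iterates z^i(k), i >= 1, take only finitely many values *)
  (exists N, forall i, 0 < i ->
      exists2 j, (0 < j <= N) & iter i z k = iter j z k) /\
  (* ... and eventually reach a fixed point of z *)
  (exists i, 0 < i /\ z (iter i z k) = iter i z k) /\
  (* c(k) = k * lcm of all the z^i(k): for any N such that z^1(k),...,z^N(k)
     exhaust all values of the iterates, the lcm is that of the first N *)
  (forall N, (forall i, 0 < i -> exists2 j, (0 < j <= N) & iter i z k = iter j z k) ->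
      c k = k * \big[lcmn/1]_(1 <= j < N.+1) iter j z k).
Proof.
have inAE n : inA k n -> 0 < n /\ n = k * z n.
  by case/and3P=> n_gt0 /divnK def_n /eqP def_k; rewrite def_k in def_n.
have iter_dvd n i : inA k n -> iter i.+1 z k %| z n.
  case/inAE=> n_gt0 def_n; elim: i => [|i IHi] /=.
    by rewrite z_dvd // def_n dvdn_mulr.
  by apply: z_dvd => //; rewrite def_n dvdn_mull.
have [n An] := hA; have [n_gt0 def_n] := inAE n An; have zn_gt0 := z_gt0 n n_gt0.
have fixed : exists i, 0 < i /\ z (iter i z k) = iter i z k.
  have bnd i : iter i.+1 z k <= z n by rewrite dvdn_leq ?iter_dvd.
  (* Pigeonhole on the iterates, all bounded by z(n), gives a periodic one. *)
  have [i [j [lt_ij eq_ij]]] := bounded_repeats _ _ bnd.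
  have per : iter (j - i) z (iter i.+1 z k) = iter i.+1 z k.
    by rewrite -iterD eq_ij; congr (iter _ _ _); lia.
  have ji_gt0 : 0 < j - i by rewrite subn_gt0.
  have [l fix_l] := periodic_fixed _ _ (iter_z_gt0 i.+1 k hk) ji_gt0 per.
  by exists (l + i.+1); rewrite iterD addnS.
split; last split=> // [N exh].
  have [i [i_gt0 fix_i]] := fixed; exists i => j j_gt0.
  have [le_ji|/ltnW le_ij] := leqP j i; first by exists j; rewrite ?j_gt0.
  exists i; rewrite ?i_gt0 ?leqnn // -(subnK le_ij) iterD.
  by elim: (j - i) => //= m ->.
rewrite big_add1 big_mkord /=; set L := \big[_/_]_(_ < _) _.
have iterL i : 0 < i -> iter i z k %| L.
  case/exh=> [[|j]] //= lt_jN ->.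
  exact: (@biglcmn_sup _ (Ordinal lt_jN)).
have Lmin m : (forall i, iter i.+1 z k %| m) -> L %| m.
  by move=> dvd_m; apply/dvdn_biglcmP => i _; apply: dvd_m.
have L_dvd m : inA k m -> L %| z m by move=> Am; apply: Lmin => i; apply: iter_dvd.
have L_gt0 : 0 < L by apply: dvdn_gt0 (L_dvd n An).
have kL_gt0 : 0 < k * L by rewrite muln_gt0 hk.
(* A prime p dividing L divides some z^i(k) with i >= 1, so z(p) divides z^(i+1)(k), hence L. *)
have zL p : prime p -> p %| L -> z p %| L.
  move=> p_pr /(prime_dvd_biglcm _ _ _ p_pr)[i p_zi].
  apply: dvdn_trans (iterL i.+2 isT); apply: z_dvd => //.
  exact: (iter_z_gt0 i.+1).
have [t def_zn] := dvdnP (L_dvd n An).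
have t_gt0 : 0 < t by case: t def_zn zn_gt0 => // ->.
have kLF : k * L %| fib L.
  apply: (@dvdn_fib_descent k L t) => //; first exact: (iterL 1).
  by rewrite (mulnC L) -def_zn -def_n dvdn_fibE.
(* Conversely every iterate divides z(kL): z(k) does since k | kL, and each later one is z of an
   iterate dividing L. *)
have z_kL : z (k * L) = L.
  apply/eqP; rewrite eqn_dvd -dvdn_fibE // kLF; apply: Lmin => -[|i].
    by rewrite z_dvd // dvdn_mulr.
  by apply: z_dvd => //; apply: dvdn_mull; apply: (iterL i.+1).
have AkL : inA k (k * L) by rewrite /inA kL_gt0 z_kL dvdn_mull // mulnK // eqxx.
rewrite /c; case: ClassicalEpsilon.excluded_middle_informative => // H.
(* Any m in A_k equals k z(m) with L | z(m), hence m >= kL. *)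
case: ex_minnP => m Am m_min; apply/eqP; rewrite eqn_leq m_min //=.
have [m_gt0 ->] := inAE m Am.
by rewrite leq_pmul2l // dvdn_leq ?L_dvd // z_gt0.
Qed.
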